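(* Let $N$ be a positive integer, $\alpha\in(0,1]$, and let $E_1,E_2\subseteq\mathbb{Z}_N$ with $|E_1|=\beta_1N$, $|E_2|=\beta_2N$, $\beta_1,\beta_2>0$. Suppose $E_1$ and $E_2$ are both $\alpha_0$-uniform, where $\alpha_0=2^{-12}\alpha^3\beta_1^{24}\beta_2^{24}$. Let $f:\mathbb{Z}_N^2\to\mathbb{C}$ satisfy $|f|\le1$, $f=0$ outside $E_1\times E_2$, and $$\sum_{y,y'\in\mathbb{Z}_N}\Big|\sum_{x\in\mathbb{Z}_N}f(x,y)\overline{f(x,y')}\Big|^2\le\alpha|E_1|^2|E_2|^2 .$$ Let $Q_1,Q_2\subseteq E_1\times E_2$ with characteristic functions $h,g$. Then $$\Big|\sum_{\vec s\in\mathbb{Z}_N^2}\sum_{r\in\mathbb{Z}_N}h(\vec s)\,g(\vec s+r(\vec e_1+\vec e_2))\,f(\vec s+r\vec e_2)\Big|\le2\alpha^{1/4}\beta_1^2\beta_2^2N^3 .$$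
   Context: $\vec e_1=(1,0)$, $\vec e_2=(0,-1)$ in $\mathbb{Z}_N^2$. A set $E\subseteq\mathbb{Z}_N$ with $|E|=\beta N$ is called $\gamma$-uniform if its balanced function $\phi=\chi_E-\beta$ satisfies $\sum_{k\in\mathbb{Z}_N}\big|\sum_{s\in\mathbb{Z}_N}\phi(s)\overline{\phi(s-k)}\big|^2\le\gamma N^3$. *)

(* Defs.v *)
From mathcomp Require Import all_boot all_order all_algebra.
From mathcomp Require Import complex.
From mathcomp Require Import reals exp.

Set Implicit Arguments.
Unset Strict Implicit.
Unset Printing Implicit Defensive.

Import Order.TTheory GRing.Theory Num.Theory.
Local Open Scope ring_scope.
Local Open Scope complex_scope.

(* Z_N for N = n.+1; unlike 'Z_N, this is also correct for N = 1. *)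
Notation ZN n := 'I_n.+1.

(* The integer multiple [e *+ r] with r : ZN n read as a nat is the scalar
   multiple r e of Z_N^2, as Z_N^2 has exponent N. *)
Definition e1 (n : nat) : ZN n * ZN n := (Zp1, 0).
Definition e2 (n : nat) : ZN n * ZN n := (0, - Zp1).

Definition charfun (R : realType) (T : finType) (A : {set T}) (x : T) : R[i] :=
  (x \in A)%:R.

Definition density (R : realType) (n : nat) (E : {set ZN n}) : R :=
  #|E|%:R / n.+1%:R.

Definition balanced (R : realType) (n : nat) (E : {set ZN n}) (s : ZN n) :
    R[i] :=
  charfun R E s - (density R E)%:C.

(* The norm of R[i] is R[i]-valued (with values in the image of R), and z <= w
   in R[i] means that w - z is a nonnegative real. *)
Definition uniform (R : realType) (n : nat) (gamma : R) (E : {set ZN n}) :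
    Prop :=
  \sum_(k : ZN n)
     `| \sum_(s : ZN n) balanced R E s * (balanced R E (s - k))^* | ^+ 2
  <= (gamma * n.+1%:R ^+ 3)%:C.

(* Main.v *)
(** Write [a] and [b] for the indicators of [E1] and [E2]. With [u = x + y] the
    sum becomes [sum h(x, u - x) g(u - y, y) f(x, y)] over [x, u, y], a triangle
    form in the pairs [(x, u)], [(u, y)], [(x, y)]. Cauchy-Schwarz over [(x, u)]
    removes [h], and Cauchy-Schwarz over [(u, y, y')] removes [g]; what remains
    of [f] is its sum over rectangles [(x, x') x (y, y')], each weighted by
    [sum_u a(u - y) a(u - y') b(u - x) b(u - x')]. Uniformity makes this weight
    close in mean square to its average [beta1^2 beta2^2 N]: its second moment
    is [N sum_k A(k)^2 B(k)^2] for the autocorrelations [A], [B] of [a], [b],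
    whose deviations from their means sum to 0 (so that the first-order error
    terms cancel) and are small in l^2. *)

Require Import Defs.
From mathcomp Require Import all_boot all_order all_algebra.
From mathcomp Require Import complex.
From mathcomp Require Import reals exp.
From mathcomp Require Import ring lra.

Set Implicit Arguments.
Unset Strict Implicit.
Unset Printing Implicit Defensive.

Import Order.TTheory GRing.Theory Num.Theory.
Local Open Scope ring_scope.
Local Open Scope complex_scope.

(** * Cauchy-Schwarz for real sums, and translation of summation variables *)

(** Lagrange's identity: the double sum of [w i * w j * (p i - p j) ^+ 2] is twice the difference of
    the two sides. The weight enters to the first power, so that a majorant supported on [E1] and
    [E2] contributes its density. *)
Lemma sqr_sum_weighted_le (R : realFieldType) (I : finType) (w p : I -> R) :
  (forall i, 0 <= w i) ->
  (\sum_i w i * p i) ^+ 2 <= (\sum_i w i) * (\sum_i w i * p i ^+ 2).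
Proof.
move=> w_ge0.
have: 0 <= \sum_i \sum_j w i * w j * (p i - p j) ^+ 2.
  by apply: sumr_ge0 => i _; apply: sumr_ge0 => j _; rewrite mulr_ge0 ?sqr_ge0 ?mulr_ge0.
have -> : \sum_i \sum_j w i * w j * (p i - p j) ^+ 2 =
    (\sum_i w i * p i ^+ 2) * (\sum_i w i)
    + ((\sum_i w i) * (\sum_i w i * p i ^+ 2)
       - 2 * ((\sum_i w i * p i) * (\sum_i w i * p i))).
  rewrite !big_distrlr /= mulr_sumr -sumrB -big_split /=; apply: eq_bigr => i _.
  rewrite mulr_sumr -sumrB -big_split /=; apply: eq_bigr => j _; ring.
lra.
Qed.

Lemma sqr_sum_le (R : realFieldType) (I : finType) (p : I -> R) :
  (\sum_i p i) ^+ 2 <= #|I|%:R * \sum_i p i ^+ 2.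
Proof.
have := @sqr_sum_weighted_le R I (fun=> 1) p (fun=> ler01).
by rewrite sumr_const !(eq_bigr _ (fun i _ => mul1r _)).
Qed.

Lemma sum_subl (V : nmodType) (G : finZmodType) (F : G -> V) (u : G) :
  \sum_y F (u - y) = \sum_y F y.
Proof. by rewrite [RHS](reindex_inj (can_inj (subKr u))). Qed.

Lemma sum_subr (V : nmodType) (G : finZmodType) (F : G -> V) (u : G) :
  \sum_y F (y - u) = \sum_y F y.
Proof. by rewrite [RHS](reindex_inj (can_inj (subrK u))). Qed.

(** * Autocorrelations, and products of functions close to their means *)

Definition autocorr (R : pzRingType) (G : finZmodType) (a : G -> R) (k : G) : R :=
  \sum_s a s * a (s - k).

Lemma autocorr_shift (R : pzRingType) (G : finZmodType) (a : G -> R) (u v : G) :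
  \sum_y a (u - y) * a (v - y) = autocorr a (u - v).
Proof.
rewrite /autocorr -[RHS](sum_subl _ u).
by apply: eq_bigr => y _; congr (_ * a _); rewrite opprB [RHS]addrC addrA subrK.
Qed.

Lemma autocorr_reflect (R : pzRingType) (G : finZmodType) (a : G -> R) (x y : G) :
  \sum_u a (u - x) * a (u - y) = autocorr a (y - x).
Proof.
rewrite /autocorr -[RHS](sum_subr _ x).
by apply: eq_bigr => u _; congr (_ * a _); rewrite opprB addrA subrK.
Qed.

Lemma sum_autocorr (R : pzRingType) (G : finZmodType) (a : G -> R) :
  \sum_k autocorr a k = (\sum_s a s) ^+ 2.
Proof.
rewrite exchange_big expr2 mulr_suml; apply: eq_bigr => s _ /=.
by rewrite -mulr_sumr sum_subl.
Qed.

(** The shift does not depend on [k]. With [c = - beta] the deviation of an autocorrelation from its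
    mean becomes the autocorrelation of the balanced function. *)
Lemma autocorr_add_cst (R : comPzRingType) (G : finZmodType) (a : G -> R) (c : R) (k : G) :
  autocorr (fun s => a s + c) k =
  autocorr a k + (2 * c * \sum_s a s + #|G|%:R * c ^+ 2).
Proof.
transitivity (\sum_s (a s * a (s - k) + (c * a s + (c * a (s - k) + c ^+ 2)))).
  by apply: eq_bigr => s _; ring.
rewrite !big_split /= -!mulr_sumr sum_subr sumr_const -[in LHS]mulr_natl /autocorr.
ring.
Qed.

(* The linear terms of [A^2 B^2] in the deviations [A - a] and [B - b] sum to 0. *)
Lemma sum_sqrM_near_le (R : realFieldType) (I : finType) (A B : I -> R) (a b eps M : R) :
  (forall i, 0 <= B i <= M) -> 0 <= a <= M -> 0 <= b <= M ->
  \sum_i (A i - a) = 0 -> \sum_i (B i - b) = 0 ->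
  \sum_i (A i - a) ^+ 2 <= eps -> \sum_i (B i - b) ^+ 2 <= eps ->
  \sum_i A i ^+ 2 * B i ^+ 2 <= #|I|%:R * (a ^+ 2 * b ^+ 2) + 6 * M ^+ 2 * eps.
Proof.
move=> BM /andP[a_ge0 aM] /andP[b_ge0 bM] A0 B0 A2 B2.
have M2 x y : 0 <= x <= M -> 0 <= y <= M -> 0 <= M ^+ 2 - x * y.
  by move=> /andP[x0 xM] /andP[y0 yM]; rewrite subr_ge0 expr2 ler_pM.
(* Put x = A - a and y = B - b, so that AB - ab = Bx + ay. In A^2 B^2 = a^2 b^2 + 2ab(AB - ab) + (AB
   - ab)^2 the cross term 2abxy costs M^2 (x^2 + y^2), by [h1] and [h2]; the last square costs 2M^2
   (x^2 + y^2), by [h3] and twice [h4] and [h5]. *)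
have pointwise i : A i ^+ 2 * B i ^+ 2 <=
    a ^+ 2 * b ^+ 2
    + (2 * a * b * b * (A i - a) + (2 * a * b * a * (B i - b)
    + (3 * M ^+ 2 * (A i - a) ^+ 2 + 3 * M ^+ 2 * (B i - b) ^+ 2))).
  have aI : 0 <= a <= M by rewrite a_ge0.
  have bI : 0 <= b <= M by rewrite b_ge0.
  have h1 := mulr_ge0 (M2 _ _ aI bI) (addr_ge0 (sqr_ge0 (A i - a)) (sqr_ge0 (B i - b))).
  have h2 := mulr_ge0 (mulr_ge0 a_ge0 b_ge0) (sqr_ge0 ((A i - a) - (B i - b))).
  have h3 := sqr_ge0 (B i * (A i - a) - a * (B i - b)).
  have h4 := mulr_ge0 (M2 _ _ (BM i) (BM i)) (sqr_ge0 (A i - a)).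
  have h5 := mulr_ge0 (M2 _ _ aI aI) (sqr_ge0 (B i - b)).
  rewrite -subr_ge0.
  move: (addr_ge0 h1 (addr_ge0 h2 (addr_ge0 h3 (addr_ge0 (addr_ge0 h4 h4) (addr_ge0 h5 h5))))).
  by congr (0 <= _); ring.
apply: le_trans (ler_sum _ (fun i _ => pointwise i)) _.
rewrite !big_split /= -!mulr_sumr A0 B0 sumr_const -mulr_natl.
have M3 : 0 <= 3 * M ^+ 2 by rewrite mulr_ge0 ?sqr_ge0.
have := ler_wpM2l M3 A2; have := ler_wpM2l M3 B2; lra.
Qed.

(** The terms linear in the deviations sum to 0, and the product of two deviations is at most half
    the sum of their squares. *)
Lemma sumM_near_le (R : realFieldType) (I : finType) (A B : I -> R) (a b eps : R) :
  \sum_i (A i - a) = 0 -> \sum_i (B i - b) = 0 ->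
  \sum_i (A i - a) ^+ 2 <= eps -> \sum_i (B i - b) ^+ 2 <= eps ->
  \sum_i A i * B i <= #|I|%:R * (a * b) + eps.
Proof.
move=> A0 B0 A2 B2.
have pointwise i : A i * B i <=
    a * b + (b * (A i - a) + (a * (B i - b)
    + (2^-1 * (A i - a) ^+ 2 + 2^-1 * (B i - b) ^+ 2))).
  by have := sqr_ge0 ((A i - a) - (B i - b)); lra.
apply: le_trans (ler_sum _ (fun i _ => pointwise i)) _.
rewrite !big_split /= -!mulr_sumr A0 B0 sumr_const -mulr_natl; lra.
Qed.

(** * Rectangle weights and their moments *)

Definition rect (R : pzRingType) (G : finZmodType) (a : G -> R) (u : G) (p : G * G) : R :=
  a (u - p.1) * a (u - p.2).

Lemma sum_pairM (R : comPzRingType) (I : finType) (F H : I -> R) :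
  \sum_(p : I * I) F p.1 * H p.2 = (\sum_i F i) * (\sum_i H i).
Proof. by rewrite big_distrlr /= pair_bigA. Qed.

Lemma sum_rect (R : comPzRingType) (G : finZmodType) (a : G -> R) (u : G) :
  \sum_p rect a u p = (\sum_s a s) ^+ 2.
Proof.
by rewrite (sum_pairM (fun y => a (u - y)) (fun y => a (u - y))) sum_subl expr2.
Qed.

Lemma sum_rectM (R : comPzRingType) (G : finZmodType) (a : G -> R) (u v : G) :
  \sum_p rect a u p * rect a v p = autocorr a (u - v) ^+ 2.
Proof.
rewrite -autocorr_shift expr2 -sum_pairM.
by apply: eq_bigr => -[x y] _; rewrite /rect /=; ring.
Qed.

(** Here [p] is a pair of first coordinates and [q] a pair of second ones. The roles cross: [u - y]
    is a first coordinate, tested by [a], and [u - x] a second one, tested by [b]. *)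
Definition joint (R : pzRingType) (G : finZmodType) (a b : G -> R) (p q : G * G) : R :=
  \sum_u rect a u q * rect b u p.

Lemma sum_joint (R : comPzRingType) (G : finZmodType) (a b : G -> R) :
  \sum_p \sum_q joint a b p q = #|G|%:R * ((\sum_s a s) ^+ 2 * (\sum_s b s) ^+ 2).
Proof.
transitivity (\sum_(u : G) (\sum_s a s) ^+ 2 * (\sum_s b s) ^+ 2); last first.
  by rewrite sumr_const mulr_natl.
under eq_bigr => p _ do rewrite exchange_big.
rewrite exchange_big; apply: eq_bigr => u _ /=.
under eq_bigr => p _ do rewrite -mulr_suml sum_rect.
by rewrite -mulr_sumr sum_rect.
Qed.

(** Opening the square gives two variables [u] and [v]. For fixed [u], [v] the sums over [q] and [p]
    separate into squared autocorrelations at [u - v], and one free variable remains. *)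
Lemma sum_sqr_joint (R : comPzRingType) (G : finZmodType) (a b : G -> R) :
  \sum_p \sum_q joint a b p q ^+ 2 =
  #|G|%:R * \sum_k autocorr a k ^+ 2 * autocorr b k ^+ 2.
Proof.
transitivity (\sum_u \sum_v autocorr a (u - v) ^+ 2 * autocorr b (u - v) ^+ 2).
  under eq_bigr => p _ do under eq_bigr => q _ do rewrite expr2 /joint big_distrlr /=.
  under eq_bigr => p _ do rewrite exchange_big.
  rewrite exchange_big; apply: eq_bigr => u _ /=.
  under eq_bigr => p _ do rewrite exchange_big.
  rewrite exchange_big; apply: eq_bigr => v _ /=.
  rewrite -!sum_rectM mulrC big_distrlr /=; apply: eq_bigr => p _.
  by apply: eq_bigr => q _; ring.
under eq_bigr => u _ do
  rewrite (sum_subl (fun k => autocorr a k ^+ 2 * autocorr b k ^+ 2)).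
by rewrite sumr_const mulr_natl.
Qed.

(** This is the total weight in the second Cauchy-Schwarz step. Summing over [u] first leaves a
    function of k = y' - y alone. *)
Lemma sum_rect_diag (R : comPzRingType) (G : finZmodType) (a b : G -> R) :
  \sum_u \sum_p rect a u p * (b p.1 * b p.2) = \sum_k autocorr a k * autocorr b k.
Proof.
rewrite exchange_big /=.
under eq_bigr => p _ do rewrite -mulr_suml autocorr_reflect.
rewrite -(pair_bigA _ (fun y y' => autocorr a (y' - y) * (b y * b y'))) exchange_big /=.
transitivity (\sum_j \sum_k autocorr a k * (b j * b (j - k))).
  apply: eq_bigr => j _; rewrite -[LHS](sum_subl _ j); apply: eq_bigr => k _.
  by rewrite subKr [b _ * b j]mulrC.
by rewrite exchange_big /=; apply: eq_bigr => k _; rewrite -mulr_sumr.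
Qed.

(** * Quasirandom functions and concentration of the rectangle weight *)

(** The last clause bounds the unnormalised fourth power of the Gowers U^2 norm of the balanced
    function. *)
Definition quasirandom (R : realFieldType) (G : finZmodType)
    (beta gamma : R) (a : G -> R) : Prop :=
  [/\ forall x, 0 <= a x <= 1,
      \sum_x a x = beta * #|G|%:R
    & \sum_k autocorr (fun s => a s - beta) k ^+ 2 <= gamma * #|G|%:R ^+ 3].

Lemma card_finZmod_gt0 (R : realFieldType) (G : finZmodType) : 0 < #|G|%:R :> R.
Proof. by rewrite ltr0n; apply/card_gt0P; exists 0. Qed.

Lemma quasirandom_density (R : realFieldType) (G : finZmodType) (beta gamma : R) (a : G -> R) :
  quasirandom beta gamma a -> 0 <= beta <= 1.
Proof.
case=> a01 asum _; have N0 := card_finZmod_gt0 R G.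
have s0 : 0 <= \sum_x a x by apply: sumr_ge0 => x _; case/andP: (a01 x).
have s1 : \sum_x a x <= \sum_(x : G) 1 by apply: ler_sum => x _; case/andP: (a01 x).
rewrite sumr_const asum in s1; rewrite asum in s0.
by rewrite -(pmulr_lge0 _ N0) s0 -(ler_pM2r N0) mul1r.
Qed.

Lemma quasirandom_autocorr_bounds (R : realFieldType) (G : finZmodType)
    (beta gamma : R) (a : G -> R) (k : G) :
  quasirandom beta gamma a -> 0 <= autocorr a k <= #|G|%:R.
Proof.
case=> a01 _ _; have a0 x : 0 <= a x by case/andP: (a01 x).
have a1 x : a x <= 1 by case/andP: (a01 x).
rewrite sumr_ge0 => [|x _]; last exact: mulr_ge0.
rewrite -(sumr_const G) /=; apply: ler_sum => x _.
by rewrite -[leRHS]mulr1 ler_pM.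
Qed.

Lemma quasirandom_autocorrE (R : realFieldType) (G : finZmodType)
    (beta gamma : R) (a : G -> R) (k : G) :
  quasirandom beta gamma a ->
  autocorr a k - beta ^+ 2 * #|G|%:R = autocorr (fun s => a s - beta) k.
Proof.
case=> _ asum _; rewrite autocorr_add_cst asum; ring.
Qed.

Lemma quasirandom_sum_autocorr (R : realFieldType) (G : finZmodType)
    (beta gamma : R) (a : G -> R) :
  quasirandom beta gamma a ->
  \sum_k (autocorr a k - beta ^+ 2 * #|G|%:R) = 0.
Proof.
case=> _ asum _; rewrite sumrB sum_autocorr asum sumr_const -[X in _ - X]mulr_natl.
ring.
Qed.

Lemma quasirandom_sum_sqr_autocorr (R : realFieldType) (G : finZmodType)
    (beta gamma : R) (a : G -> R) :
  quasirandom beta gamma a ->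
  \sum_k (autocorr a k - beta ^+ 2 * #|G|%:R) ^+ 2 <= gamma * #|G|%:R ^+ 3.
Proof.
move=> qa; under eq_bigr => k _ do rewrite (quasirandom_autocorrE _ qa).
by case: qa.
Qed.

Lemma quasirandom_rect_count (R : realFieldType) (G : finZmodType)
    (beta1 beta2 gamma : R) (a b : G -> R) :
  quasirandom beta1 gamma a -> quasirandom beta2 gamma b ->
  \sum_u \sum_p rect a u p * (b p.1 * b p.2) <=
  (beta1 ^+ 2 * beta2 ^+ 2 + gamma) * #|G|%:R ^+ 3.
Proof.
move=> qa qb; rewrite sum_rect_diag.
apply: le_trans (sumM_near_le (quasirandom_sum_autocorr qa) (quasirandom_sum_autocorr qb)
  (quasirandom_sum_sqr_autocorr qa) (quasirandom_sum_sqr_autocorr qb)) _.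
by rewrite le_eqVlt; apply/orP; left; apply/eqP; ring.
Qed.

(** The constant [W0] is the exact mean of [joint], so the variance is the second moment minus
    [N ^+ 4 * W0 ^+ 2]. That is also the main term of [sum_sqrM_near_le] with [M = N], after
    multiplication by [N]; only its error term survives. *)
Lemma quasirandom_joint_variance (R : realFieldType) (G : finZmodType)
    (beta1 beta2 gamma : R) (a b : G -> R) :
  quasirandom beta1 gamma a -> quasirandom beta2 gamma b ->
  \sum_p \sum_q (joint a b p q - beta1 ^+ 2 * beta2 ^+ 2 * #|G|%:R) ^+ 2 <=
  6 * gamma * #|G|%:R ^+ 6.
Proof.
move=> qa qb; set N : R := #|G|%:R; set W0 := _ * N.
have N0 : 0 < N := card_finZmod_gt0 R G.
have -> : \sum_p \sum_q (joint a b p q - W0) ^+ 2 =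
    \sum_p \sum_q joint a b p q ^+ 2 - 2 * W0 * \sum_p \sum_q joint a b p q
    + N ^+ 4 * W0 ^+ 2.
  have -> : N ^+ 4 * W0 ^+ 2 = \sum_(p : G * G) \sum_(q : G * G) W0 ^+ 2.
    rewrite !sumr_const -!mulrnA -mulr_natl card_prod !natrM -/N; ring.
  rewrite mulr_sumr -sumrB -big_split /=; apply: eq_bigr => p _.
  rewrite mulr_sumr -sumrB -big_split /=; apply: eq_bigr => q _.
  ring.
rewrite sum_joint sum_sqr_joint.
case: (qa) => _ -> _; case: (qb) => _ -> _; rewrite -/N.
have bound beta (c : G -> R) : quasirandom beta gamma c -> 0 <= beta ^+ 2 * N <= N.
  move=> /quasirandom_density /andP[b0 b1].
  by rewrite mulr_ge0 ?sqr_ge0 ?(ltW N0) // ger_pMl // exprn_ile1.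
have := sum_sqrM_near_le (fun k => quasirandom_autocorr_bounds k qb)
  (bound _ _ qa) (bound _ _ qb)
  (quasirandom_sum_autocorr qa) (quasirandom_sum_autocorr qb)
  (quasirandom_sum_sqr_autocorr qa) (quasirandom_sum_sqr_autocorr qb).
rewrite -(ler_pM2l N0) -/N; move: (\sum_k _ * _) => s; rewrite /W0; lra.
Qed.

(** * The modulus of a complex number with values in [R], where the estimates take place *)

Notation normc := ComplexField.Normc.normc.

Lemma normcE (R : realType) (z : R[i]) : (normc z)%:C = `|z|.
Proof. by []. Qed.

Lemma normc_ge0 (R : realType) (z : R[i]) : 0 <= normc z.
Proof. by rewrite -ler0c normcE. Qed.

Lemma ler_normcD (R : realType) (z w : R[i]) : normc (z + w) <= normc z + normc w.
Proof. by rewrite -lecR rmorphD /= !normcE; exact: ler_normD. Qed.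

Lemma ler_normc_sum (R : realType) (I : finType) (F : I -> R[i]) :
  normc (\sum_i F i) <= \sum_i normc (F i).
Proof.
by rewrite -lecR normcE rmorph_sum; exact: ler_norm_sum.
Qed.

Lemma sqr_normcE (R : realType) (z : R[i]) : (normc z ^+ 2)%:C = z * z^*.
Proof. by rewrite rmorphXn /= normcE sqr_normc. Qed.

Lemma normc_conj (R : realType) (z : R[i]) : normc z^* = normc z.
Proof. by apply: complexI; rewrite !normcE normcJ. Qed.

Lemma normc_real (R : realType) (x : R) : normc x%:C = `|x|.
Proof. by rewrite /= expr0n /= addr0 sqrtr_sqr. Qed.

(* Inside a ring operation [^*] parses as [Num.conj], elsewhere as [conjc]; the
   two are convertible, but rewriting does not identify them. *)
Lemma conj_real_complex (R : realType) (x : R) : ((x%:C)^*)%R = x%:C.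
Proof. exact: conjc_real. Qed.

(** * The triangle form and the two applications of Cauchy-Schwarz *)

Definition triangle_form (R : realType) (G : finZmodType) (h g f : G -> G -> R[i]) : R[i] :=
  \sum_x \sum_u \sum_y h x (u - x) * g (u - y) y * f x y.

(** Of the majorant [a x * b (u - x)] of [h], the first factor has been bounded by 1 and the second
    stays as a weight. *)
Definition first_moment (R : realType) (G : finZmodType)
    (b : G -> R) (g f : G -> G -> R[i]) : R :=
  \sum_x \sum_u b (u - x) * normc (\sum_y g (u - y) y * f x y) ^+ 2.

(** The factors of [a] from the two copies of [g] stay in [rect]; those of [b] have been bounded by
    1. *)
Definition second_moment (R : realType) (G : finZmodType)
    (a b : G -> R) (f : G -> G -> R[i]) : R :=
  \sum_u \sum_q rect a u q * normc (\sum_x (b (u - x))%:C * (f x q.1 * (f x q.2)^*)) ^+ 2.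

Lemma sqr_triangle_form_le (R : realType) (G : finZmodType) (a b : G -> R)
    (h g f : G -> G -> R[i]) :
  (forall x, 0 <= a x <= 1) -> (forall x, 0 <= b x) ->
  (forall x y, normc (h x y) <= a x * b y) ->
  normc (triangle_form h g f) ^+ 2 <=
  (\sum_x a x) * (\sum_y b y) * first_moment b g f.
Proof.
move=> a01 b0 hab; have a0 x : 0 <= a x by case/andP: (a01 x).
pose w (p : G * G) := a p.1 * b (p.2 - p.1).
pose z (p : G * G) := \sum_y g (p.2 - y) y * f p.1 y.
have w0 p : 0 <= w p by rewrite mulr_ge0.
have -> : triangle_form h g f = \sum_p h p.1 (p.2 - p.1) * z p.
  rewrite -(pair_bigA _ (fun x u => h x (u - x) * z (x, u))).
  apply: eq_bigr => x _; apply: eq_bigr => u _ /=; rewrite mulr_sumr.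
  by apply: eq_bigr => y _; rewrite mulrA.
have -> : (\sum_x a x) * (\sum_y b y) = \sum_p w p.
  rewrite -(pair_bigA _ (fun x u => a x * b (u - x))) mulr_suml.
  by apply: eq_bigr => x _; rewrite -mulr_sumr sum_subr.
have le1 : normc (\sum_p h p.1 (p.2 - p.1) * z p) <= \sum_p w p * normc (z p).
  apply: le_trans (ler_normc_sum _) _; apply: ler_sum => p _.
  by rewrite ComplexField.Normc.normcM ler_wpM2r ?normc_ge0.
apply: (@le_trans _ _ ((\sum_p w p * normc (z p)) ^+ 2)).
  by rewrite ler_sqr // nnegrE ?normc_ge0 // (le_trans _ le1) ?normc_ge0.
apply: le_trans (sqr_sum_weighted_le _ w0) _.
rewrite ler_wpM2l ?sumr_ge0 // /first_moment pair_bigA; apply: ler_sum => -[x u] _ /=.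
rewrite ler_wpM2r ?sqr_ge0 // /w /= ler_piMl //.
by case/andP: (a01 x).
Qed.

(** Opening the square and moving the sum over [x] inside leaves both factors of [g] outside it,
    ready for removal by the second Cauchy-Schwarz step. *)
Lemma first_momentE (R : realType) (G : finZmodType) (b : G -> R) (g f : G -> G -> R[i]) :
  (first_moment b g f)%:C =
  \sum_u \sum_(q : G * G) g (u - q.1) q.1 * (g (u - q.2) q.2)^* *
    \sum_x (b (u - x))%:C * (f x q.1 * (f x q.2)^*).
Proof.
rewrite /first_moment exchange_big rmorph_sum; apply: eq_bigr => u _ /=.
rewrite rmorph_sum.
under [RHS]eq_bigr => q _ do rewrite mulr_sumr.
rewrite [RHS]exchange_big; apply: eq_bigr => x _ /=.
rewrite rmorphM /= sqr_normcE rmorph_sum big_distrlr /= mulr_sumr -(pair_bigA _ (fun y y' =>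
  g (u - y) y * (g (u - y') y')^* * ((b (u - x))%:C * (f x y * (f x y')^*)))).
apply: eq_bigr => y _; rewrite mulr_sumr; apply: eq_bigr => y' _.
rewrite rmorphM /=; ring.
Qed.

Lemma sqr_first_moment_le (R : realType) (G : finZmodType) (a b : G -> R)
    (g f : G -> G -> R[i]) :
  (forall x, 0 <= a x) -> (forall x, 0 <= b x <= 1) ->
  (forall x y, normc (g x y) <= a x * b y) ->
  first_moment b g f ^+ 2 <=
  (\sum_u \sum_p rect a u p * (b p.1 * b p.2)) * second_moment a b f.
Proof.
move=> a0 b01 gab; have b0 x : 0 <= b x by case/andP: (b01 x).
have r0 u p : 0 <= rect a u p by rewrite mulr_ge0.
pose z (p : G * (G * G)) := \sum_x (b (p.1 - x))%:C * (f x p.2.1 * (f x p.2.2)^*).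
pose w (p : G * (G * G)) := rect a p.1 p.2 * (b p.2.1 * b p.2.2).
have w0 p : 0 <= w p by rewrite !mulr_ge0.
have P0 : 0 <= first_moment b g f.
  by apply: sumr_ge0 => x _; apply: sumr_ge0 => u _; rewrite mulr_ge0 ?sqr_ge0.
have le1 : first_moment b g f <= \sum_p w p * normc (z p).
  (* The expansion lives in [R[i]], so the nonnegative real [first_moment] is read as its own
     modulus. *)
  rewrite -(ger0_norm P0) -normc_real first_momentE pair_bigA.
  apply: le_trans (ler_normc_sum _) _; apply: ler_sum => -[u [y y']] _ /=.
  rewrite !ComplexField.Normc.normcM normc_conj ler_wpM2r ?normc_ge0 //.
  rewrite (_ : w _ = a (u - y) * b y * (a (u - y') * b y')); last by rewrite /w /rect /=; ring.
  by rewrite ler_pM ?normc_ge0.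
apply: (@le_trans _ _ ((\sum_p w p * normc (z p)) ^+ 2)).
  by rewrite ler_sqr // nnegrE // (le_trans _ le1).
apply: le_trans (sqr_sum_weighted_le _ w0) _.
rewrite pair_bigA ler_wpM2l ?sumr_ge0 // /second_moment pair_bigA.
apply: ler_sum => -[u [y y']] _ /=.
rewrite ler_wpM2r ?sqr_ge0 // /w /= ler_piMr // -[leRHS]mulr1.
by case/andP: (b01 y) => ? ?; case/andP: (b01 y') => ? ?; rewrite ler_pM.
Qed.

(** * Replacing the rectangle weight by its mean *)

(** The product of [f] over the corners of a rectangle, conjugated alternately; summed over all
    rectangles it is the fourth power of the unnormalised box norm of [f]. *)
Definition quad (R : realType) (G : finZmodType) (f : G -> G -> R[i]) (p q : G * G) : R[i] :=
  f p.1 q.1 * (f p.1 q.2)^* * (f p.2 q.1 * (f p.2 q.2)^*)^*.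

Lemma sum_quad (R : realType) (G : finZmodType) (f : G -> G -> R[i]) (c : G -> R) (q : G * G) :
  \sum_p (c p.1 * c p.2)%:C * quad f p q =
  (\sum_x (c x)%:C * (f x q.1 * (f x q.2)^*)) * (\sum_x (c x)%:C * (f x q.1 * (f x q.2)^*))^*.
Proof.
rewrite rmorph_sum big_distrlr pair_bigA; apply: eq_bigr => -[x x'] _ /=.
rewrite /quad /= !rmorphM /= conj_real_complex; ring.
Qed.

Lemma second_momentE (R : realType) (G : finZmodType) (a b : G -> R) (f : G -> G -> R[i]) :
  (second_moment a b f)%:C = \sum_p \sum_q (joint a b p q)%:C * quad f p q.
Proof.
rewrite exchange_big /=.
transitivity (\sum_(q : G * G) \sum_u \sum_p (rect a u q * rect b u p)%:C * quad f p q); last first.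
  apply: eq_bigr => q _; rewrite exchange_big; apply: eq_bigr => p _ /=.
  by rewrite rmorph_sum mulr_suml.
rewrite exchange_big rmorph_sum; apply: eq_bigr => u _ /=.
rewrite rmorph_sum; apply: eq_bigr => q _ /=.
rewrite rmorphM /= sqr_normcE -(sum_quad f (fun x => b (u - x))) mulr_sumr.
apply: eq_bigr => p _; rewrite /rect !rmorphM /=; ring.
Qed.

(** With constant weight [W] the rectangle sum is [W] times the box norm quantity. As [quad] has
    modulus at most 1, the change of weight costs at most its l^1 distance from [W]. *)
Lemma second_moment_le (R : realType) (G : finZmodType)
    (a b : G -> R) (f : G -> G -> R[i]) (W : R) :
  (forall x, 0 <= a x) -> 0 <= W -> (forall x y, normc (f x y) <= 1) ->
  second_moment a b f <=
  W * (\sum_(q : G * G) normc (\sum_x f x q.1 * (f x q.2)^*) ^+ 2)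
  + \sum_p \sum_q `|joint a b p q - W|.
Proof.
move=> a0 W0 f1.
have T0 : 0 <= second_moment a b f.
  by apply: sumr_ge0 => u _; apply: sumr_ge0 => q _; rewrite mulr_ge0 ?sqr_ge0 // mulr_ge0.
set M := \sum_(q : G * G) _.
have M0 : 0 <= M by apply: sumr_ge0 => q _; rewrite sqr_ge0.
have ME : M%:C = \sum_p \sum_q quad f p q.
  rewrite exchange_big rmorph_sum; apply: eq_bigr => q _ /=.
  by rewrite sqr_normcE rmorph_sum big_distrlr pair_bigA.
  have quad1 p q : normc (quad f p q) <= 1.
  rewrite /quad !(normc_conj, ComplexField.Normc.normcM).
  by rewrite -[leRHS]mulr1 ler_pM ?mulr_ge0 ?normc_ge0 // -[leRHS]mulr1 ler_pM ?normc_ge0.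
have TE : (second_moment a b f)%:C =
    (W * M)%:C + \sum_p \sum_q (joint a b p q - W)%:C * quad f p q.
  rewrite second_momentE rmorphM /= ME mulr_sumr -big_split; apply: eq_bigr => p _ /=.
  rewrite mulr_sumr -big_split; apply: eq_bigr => q _ /=.
  rewrite rmorphB /=; ring.
rewrite -(ger0_norm T0) -normc_real TE.
apply: le_trans (ler_normcD _ _) _.
rewrite normc_real ger0_norm ?mulr_ge0 // lerD2l.
apply: le_trans (ler_normc_sum _) _; apply: ler_sum => p _.
apply: le_trans (ler_normc_sum _) _; apply: ler_sum => q _.
by rewrite ComplexField.Normc.normcM normc_real ler_piMr.
Qed.

(** Cauchy-Schwarz over the N^4 choices of [(p, q)] turns the variance bound into an l^1 bound. *)
Lemma sum_joint_dist_le (R : realFieldType) (G : finZmodType)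
    (beta1 beta2 gamma eps : R) (a b : G -> R) :
  quasirandom beta1 gamma a -> quasirandom beta2 gamma b ->
  0 <= eps -> 6 * gamma <= eps ^+ 2 ->
  \sum_p \sum_q `|joint a b p q - beta1 ^+ 2 * beta2 ^+ 2 * #|G|%:R| <=
  eps * #|G|%:R ^+ 5.
Proof.
move=> qa qb eps0 gamma_eps; set N : R := #|G|%:R; set W0 := _ * N.
have N0 : 0 < N := card_finZmod_gt0 R G.
rewrite -ler_sqr ?nnegrE; last 2 first.
- by apply: sumr_ge0 => p _; apply: sumr_ge0.
- by rewrite mulr_ge0 // exprn_ge0 // ltW.
rewrite pair_bigA; apply: le_trans (sqr_sum_le _) _.
have -> : #|{: (G * G) * (G * G)}|%:R = N ^+ 4 :> R.
  by rewrite !card_prod !natrM -/N; ring.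
under eq_bigr => z _ do rewrite real_normK ?num_real //.
rewrite -(pair_bigA _ (fun p q => (joint a b p q - W0) ^+ 2)).
apply: (@le_trans _ _ (N ^+ 4 * (6 * gamma * N ^+ 6))).
  by rewrite ler_pM2l ?exprn_gt0 //; exact: quasirandom_joint_variance.
rewrite (_ : N ^+ 4 * _ = 6 * gamma * N ^+ 10); last ring.
rewrite (_ : (_ * _) ^+ 2 = eps ^+ 2 * N ^+ 10); last ring.
by rewrite ler_pM2r // exprn_gt0.
Qed.

(** * Assembling the estimates *)

(** With S the form, D the product of the masses of [a] and [b], C the weight in
    [quasirandom_rect_count] and T the second moment, the two Cauchy-Schwarz steps give |S|^4 <= D^2
    C T. *)
Lemma triangle_form_le (R : realType) (G : finZmodType)
    (alpha beta1 beta2 : R) (a b : G -> R) (h g f : G -> G -> R[i]) :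
  0 < alpha <= 1 -> 0 < beta1 -> 0 < beta2 ->
  quasirandom beta1 (2 ^- 12 * alpha ^+ 3 * beta1 ^+ 24 * beta2 ^+ 24) a ->
  quasirandom beta2 (2 ^- 12 * alpha ^+ 3 * beta1 ^+ 24 * beta2 ^+ 24) b ->
  (forall x y, normc (h x y) <= a x * b y) ->
  (forall x y, normc (g x y) <= a x * b y) ->
  (forall x y, normc (f x y) <= 1) ->
  \sum_(q : G * G) normc (\sum_x f x q.1 * (f x q.2)^*) ^+ 2 <=
    alpha * (beta1 * #|G|%:R) ^+ 2 * (beta2 * #|G|%:R) ^+ 2 ->
  normc (triangle_form h g f) <=
    2 * alpha `^ (4^-1) * beta1 ^+ 2 * beta2 ^+ 2 * #|G|%:R ^+ 3.
Proof.
move=> /andP[alpha0 alpha1] beta1_gt0 beta2_gt0; set gamma := _ * _ => qa qb hab gab f1 fM.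
set N : R := #|G|%:R in fM *.
have N0 : 0 < N := card_finZmod_gt0 R G.
pose c := beta1 * beta2.
have c0 : 0 < c by rewrite mulr_gt0.
have c1 : c <= 1.
  have /andP[b10 b11] := quasirandom_density qa; have /andP[b20 b21] := quasirandom_density qb.
  by rewrite -[leRHS]mulr1 ler_pM.
have [alpha_ge0 c_ge0 N_ge0] : [/\ 0 <= alpha, 0 <= c & 0 <= N] by split; exact: ltW.
have [beta1_ge0 beta2_ge0] : 0 <= beta1 /\ 0 <= beta2 by split; exact: ltW.
have gammaE : gamma = 2 ^- 12 * alpha ^+ 3 * c ^+ 24 by rewrite /gamma /c; ring.
have gamma_small : 6 * gamma <= alpha ^+ 2 * c ^+ 8.
  have -> : 6 * gamma = (6 * 2 ^- 12) * (alpha * c ^+ 16) * (alpha ^+ 2 * c ^+ 8).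
    by rewrite gammaE; ring.
  rewrite ler_piMl ?mulr_ge0 ?exprn_ge0 //.
  have : alpha * c ^+ 16 <= 1.
    by rewrite -[leRHS]mulr1 ler_pM ?exprn_ge0 ?exprn_ile1 //.
  have : 0 <= alpha * c ^+ 16 by rewrite mulr_ge0 ?exprn_ge0 //.
  move: (alpha * _) => t; lra.
have a01 x : 0 <= a x <= 1 by case: qa.
have b01 x : 0 <= b x <= 1 by case: qb.
have a0 x : 0 <= a x by case/andP: (a01 x).
have b0 x : 0 <= b x by case/andP: (b01 x).
have W0 : 0 <= beta1 ^+ 2 * beta2 ^+ 2 * N by rewrite mulr_ge0 // mulr_ge0 ?sqr_ge0.
(* This is the value of [eps] for [sum_joint_dist_le]: the error then equals the bound c^2 N * alpha
   c^2 N^4 for the main term, whence the factor 2 in [T_le]. *)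
have eps0 : 0 <= alpha * c ^+ 4 by rewrite mulr_ge0 ?exprn_ge0 //.
have D_eq : (\sum_x a x) * (\sum_y b y) = c * N ^+ 2.
  by case: qa => _ -> _; case: qb => _ -> _; rewrite /c; ring.
have C_le : \sum_u \sum_p rect a u p * (b p.1 * b p.2) <= 2 * c ^+ 2 * N ^+ 3.
  apply: le_trans (quasirandom_rect_count qa qb) _.
  rewrite ler_pM2r ?exprn_gt0 // -exprMn -/c.
  have : alpha ^+ 2 * c ^+ 8 <= c ^+ 2.
    rewrite (_ : alpha ^+ 2 * c ^+ 8 = (alpha ^+ 2 * c ^+ 6) * c ^+ 2); last ring.
    rewrite ler_piMl ?sqr_ge0 // -[leRHS]mulr1.
    by rewrite ler_pM ?exprn_ge0 ?exprn_ile1 //.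
  have : 0 <= gamma by rewrite gammaE mulr_ge0 ?exprn_ge0 //
    mulr_ge0 ?exprn_ge0 // invr_ge0 exprn_ge0.
  lra.
have T_le : second_moment a b f <= 2 * (alpha * c ^+ 4) * N ^+ 5.
  apply: le_trans (second_moment_le b a0 W0 f1) _.
  have err : \sum_p \sum_q `|joint a b p q - beta1 ^+ 2 * beta2 ^+ 2 * N| <=
      alpha * c ^+ 4 * N ^+ 5.
    apply: (sum_joint_dist_le qa qb eps0).
    by rewrite exprMn -exprM.
  have main := ler_wpM2l W0 fM.
  apply: le_trans (lerD main err) _.
  by rewrite le_eqVlt; apply/orP; left; apply/eqP; rewrite /c; ring.
have T0 : 0 <= second_moment a b f.
  by apply: sumr_ge0 => u _; apply: sumr_ge0 => q _; rewrite mulr_ge0 ?sqr_ge0 // mulr_ge0.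
have C0 : 0 <= \sum_u \sum_p rect a u p * (b p.1 * b p.2).
  by apply: sumr_ge0 => u _; apply: sumr_ge0 => q _; rewrite !mulr_ge0.
have P_le := sqr_first_moment_le f a0 b01 gab.
have S_le := sqr_triangle_form_le g f a01 b0 hab.
rewrite D_eq in S_le.
(* In fourth powers D^2 C T is at most c^2 N^4 * 2 c^2 N^3 * 2 alpha c^4 N^5 = 4 alpha c^8 N^12,
   against 16 alpha c^8 N^12 on the right. *)
rewrite -(@ler_pXn2r _ 4) ?nnegrE ?normc_ge0 //; last first.
  by rewrite !mulr_ge0 ?powR_ge0 ?exprn_ge0 //.
have -> : (2 * alpha `^ 4^-1 * beta1 ^+ 2 * beta2 ^+ 2 * N ^+ 3) ^+ 4 =
    16 * alpha * c ^+ 8 * N ^+ 12.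
  have root4 : (alpha `^ 4^-1) ^+ 4 = alpha.
    by rewrite -powR_mulrn ?powR_ge0 // -powRrM mulVf ?pnatr_eq0 // powRr1.
  by rewrite -[in RHS]root4; move: (alpha `^ _) => t; rewrite /c; ring.
apply: (@le_trans _ _ ((c * N ^+ 2) ^+ 2 * first_moment b g f ^+ 2)).
  by rewrite -exprMn (exprM _ 2 2) ler_pXn2r ?nnegrE ?sqr_ge0 // (le_trans _ S_le) ?sqr_ge0.
apply: (@le_trans _ _ ((c * N ^+ 2) ^+ 2 *
    (2 * c ^+ 2 * N ^+ 3 * (2 * (alpha * c ^+ 4) * N ^+ 5)))).
  by rewrite ler_wpM2l ?sqr_ge0 // (le_trans P_le) // ler_pM.
rewrite (_ : (c * _) ^+ 2 * _ = 4 * (alpha * c ^+ 8 * N ^+ 12)); last ring.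
rewrite (_ : 16 * alpha * _ * _ = 16 * (alpha * c ^+ 8 * N ^+ 12)); last ring.
by rewrite ler_wpM2r ?ler_nat // !mulr_ge0 ?exprn_ge0 //.
Qed.

(** * Passage from sets in Z_N to the triangle form *)

Definition indic (R : realType) (n : nat) (E : {set ZN n}) (x : ZN n) : R := (x \in E)%:R.

Lemma uniform_quasirandom (R : realType) (n : nat) (beta gamma : R) (E : {set ZN n}) :
  #|E|%:R = beta * n.+1%:R -> uniform gamma E -> quasirandom beta gamma (indic R E).
Proof.
move=> cardE unifE; split.
- by move=> x; rewrite ler0n lern1 leq_b1.
- rewrite card_ord -cardE -sum1_card natr_sum [RHS]big_mkcond /=.
  by apply: eq_bigr => x _; rewrite /indic; case: (x \in E).
rewrite card_ord -lecR; apply: le_trans unifE.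
have densityE : density R E = beta by rewrite /density cardE mulfK ?pnatr_eq0.
have balE s : balanced R E s = (indic R E s - beta)%:C.
  by rewrite /balanced /charfun densityE rmorphB /= /indic rmorph_nat.
rewrite rmorph_sum; apply: ler_sum => k _ /=.
under [X in _ <= `|X| ^+ 2]eq_bigr => s _ do rewrite !balE conj_real_complex -rmorphM.
rewrite -rmorph_sum -/(autocorr _ _) sqr_normc conjc_real -rmorphM /= expr2.
exact: lexx.
Qed.

(** The value of [Zp1] is 1 reduced modulo [n.+1]; keeping the reduction covers the trivial group,
    where it is 0. *)
Lemma Zp1_mulrn (n : nat) (r : ZN n) : Zp1 *+ r = r.
Proof. by rewrite Zp_mulrn; apply: val_inj; rewrite /= modnMml mul1n modn_small. Qed.

Lemma corner_sumE (R : realType) (n : nat) (h g f : ZN n * ZN n -> R[i]) :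
  \sum_(s : ZN n * ZN n) \sum_(r : ZN n)
     h s * g (s + (e1 n + e2 n) *+ r) * f (s + e2 n *+ r) =
  triangle_form (fun x y => h (x, y)) (fun x y => g (x, y)) (fun x y => f (x, y)).
Proof.
have e1r (r : ZN n) : e1 n *+ r = (r, 0) by rewrite pairMnE /= Zp1_mulrn mul0rn.
have e2r (r : ZN n) : e2 n *+ r = (0, - r) by rewrite pairMnE /= mulNrn Zp1_mulrn mul0rn.
transitivity (\sum_x \sum_y \sum_r h (x, y) * g (x + r, y - r) * f (x, y - r)).
  rewrite [RHS]pair_bigA; apply: eq_bigr => -[x y] _; apply: eq_bigr => r _ /=.
  rewrite mulrnDl e1r e2r -[(x, y) + (_ + _)]/(x + (r + 0), y + (0 - r)).
  by rewrite -[(x, y) + _]/(x + 0, y - r) !addr0 add0r.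
(* First the old [y] becomes [u - x], then [r] becomes [u - x - y]. The new [y] is the second
   coordinate shared by the points of [g] and [f]. *)
apply: eq_bigr => x _; rewrite -[LHS](sum_subr _ x); apply: eq_bigr => u _.
rewrite -[LHS](sum_subl _ (u - x)); apply: eq_bigr => y _.
by rewrite subKr addrA [x + _]addrC subrK.
Qed.

Theorem theorem3p8 (R : realType) (n : nat) (alpha beta1 beta2 : R)
    (E1 E2 : {set ZN n}) (f : ZN n * ZN n -> R[i])
    (Q1 Q2 : {set ZN n * ZN n}) :
  0 < alpha <= 1 ->
  #|E1|%:R = beta1 * n.+1%:R ->
  #|E2|%:R = beta2 * n.+1%:R ->
  0 < beta1 ->
  0 < beta2 ->
  uniform (2 ^- 12 * alpha ^+ 3 * beta1 ^+ 24 * beta2 ^+ 24) E1 ->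
  uniform (2 ^- 12 * alpha ^+ 3 * beta1 ^+ 24 * beta2 ^+ 24) E2 ->
  (forall s, `|f s| <= 1) ->
  (forall s, s \notin setX E1 E2 -> f s = 0) ->
  \sum_(y : ZN n) \sum_(y' : ZN n)
     `| \sum_(x : ZN n) f (x, y) * (f (x, y'))^* | ^+ 2
    <= (alpha * #|E1|%:R ^+ 2 * #|E2|%:R ^+ 2)%:C ->
  Q1 \subset setX E1 E2 ->
  Q2 \subset setX E1 E2 ->
  `| \sum_(s : ZN n * ZN n) \sum_(r : ZN n)
       charfun R Q1 s * charfun R Q2 (s + (e1 n + e2 n) *+ r)
         * f (s + e2 n *+ r) |
    <= (2 * alpha `^ (4^-1) * beta1 ^+ 2 * beta2 ^+ 2 * n.+1%:R ^+ 3)%:C.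
Proof.
move=> alpha01 card1 card2 beta1_gt0 beta2_gt0 unif1 unif2 f1 _ fM sub1 sub2.
rewrite corner_sumE -normcE lecR -[in leRHS](card_ord n.+1).
have charfun_le (Q : {set ZN n * ZN n}) x y : Q \subset setX E1 E2 ->
    normc (charfun R Q (x, y)) <= indic R E1 x * indic R E2 y.
  move=> /subsetP subQ.
  rewrite -lecR normcE /charfun normr_nat /indic -natrM rmorph_nat ler_nat.
  by have := subQ (x, y); rewrite in_setX mulnb; case: (_ \in Q) => // /(_ isT) ->.
apply: (triangle_form_le alpha01 beta1_gt0 beta2_gt0
  (uniform_quasirandom card1 unif1) (uniform_quasirandom card2 unif2)).
- by move=> x y; apply: charfun_le.
- by move=> x y; apply: charfun_le.
- by move=> x y; rewrite -lecR normcE; apply: f1.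
rewrite card_ord -card1 -card2 -lecR rmorph_sum; apply: le_trans fM.
rewrite pair_bigA; apply: ler_sum => -[y y'] _ /=.
by rewrite rmorphXn.
Qed.
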